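(* Let $H=(V,E)$ be a finite $3$-uniform hypergraph with $n=|V|$ vertices, $m=|E|$ edges and $p$ components. Then $\tau_c'(H)\le 2m-n+p$.
   Context: A hypergraph $H=(V,E)$ consists of a finite vertex set $V$ and a set $E$ of edges, each edge being a subset of $V$. $H$ is $3$-uniform if $|e|=3$ for each $e\in E$. For an integer $k\ge 2$, a cycle of length $k$ in $H$ is a sequence $v_1e_1v_2e_2\cdots v_ke_kv_1$ such that $e_1,\dots,e_k$ are distinct edges of $H$, $v_1,\dots,v_k$ are distinct vertices of $H$, and $\{v_i,v_{i+1}\}\subseteq e_i$ for each $i\in\{1,\dots,k\}$, where $v_{k+1}=v_1$. For $A\subseteq E$, $H\setminus A$ is the hypergraph $(V,E\setminus A)$ (the edges of $A$ are deleted and all vertices are kept). A set $A\subseteq E$ is a feedback edge set (FES) of $H$ if $H\setminus A$ has no cycle. $\tau_c'(H)$ denotes the minimum cardinality of a FES of $H$. The components of $H$ are its maximal connected subhypergraphs, where two vertices are connected if they are joined by a sequence of edges in which consecutive edges intersect, the first containing one vertex and the last containing the other (every vertex is connected to itself; an isolated vertex counts as a component). *)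

(* Defs.v *)
From mathcomp Require Import all_boot all_order all_algebra.

Set Implicit Arguments.
Unset Strict Implicit.
Unset Printing Implicit Defensive.

(* A hypergraph is a finite vertex type T together with E : {set {set T}}. *)
Definition uniform3 (T : finType) (E : {set {set T}}) :=
  [forall e in E, #|e| == 3].

(* The indices 1, ..., k are shifted to 0, ..., k-1, and ordS is the cyclic
   successor, so that ordS (k-1) = 0. *)
Definition is_cycle (T : finType) (E : {set {set T}}) k
    (v : {ffun 'I_k -> T}) (e : {ffun 'I_k -> {set T}}) :=
  [&& 2 <= k, injectiveb e, injectiveb v, [forall i, e i \in E]
    & [forall i, [set v i; v (ordS i)] \subset e i]].

(* Bounding k makes the predicate boolean; no cycle is lost because its
   vertices are distinct (has_cycleP). *)
Definition has_cycle (T : finType) (E : {set {set T}}) :=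
  [exists k : 'I_#|T|.+1, exists v : {ffun 'I_k -> T},
    exists e : {ffun 'I_k -> {set T}}, is_cycle E v e].

Lemma has_cycleP (T : finType) (E : {set {set T}}) :
  reflect (exists k (v : {ffun 'I_k -> T}) (e : {ffun 'I_k -> {set T}}),
             is_cycle E v e)
          (has_cycle E).
Proof.
apply: (iffP existsP) => [[k /existsP[v /existsP[e c]]]|[k [v [e c]]]].
  by exists k, v, e.
have ltk : k < #|T|.+1.
  case/and5P: c => _ _ /injectiveP injv _ _.
  by rewrite ltnS -[k]card_ord; exact: leq_card injv.
by exists (Ordinal ltk); apply/existsP; exists v; apply/existsP; exists e.
Qed.

Definition fes (T : finType) (E A : {set {set T}}) :=
  (A \subset E) && ~~ has_cycle (E :\: A).

(* The set E, which starts the minimization, is itself a FES (fes_edges). *)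
Definition tau (T : finType) (E : {set {set T}}) : nat :=
  #|[arg min_(A < E | fes E A) #|A|]|.

Lemma fes_edges (T : finType) (E : {set {set T}}) : fes E E.
Proof.
rewrite /fes subxx /= setDv; apply/has_cycleP => -[k [v [e]]].
case/and5P => k2 _ _ /forallP /(_ (Ordinal (ltnW k2))).
by rewrite inE.
Qed.

Lemma tauP (T : finType) (E : {set {set T}}) :
  (exists2 A, fes E A & #|A| = tau E) /\ (forall A, fes E A -> tau E <= #|A|).
Proof.
rewrite /tau; case: arg_minnP => [|A fA minA]; first exact: fes_edges.
by split=> [|B fB]; [exists A | exact: minA].
Qed.

Definition edge_joined (T : finType) (E : {set {set T}}) : rel {set T} :=
  connect [rel e f | [&& e \in E, f \in E & e :&: f != set0]].

Definition connected_in (T : finType) (E : {set {set T}}) : rel T := fun x y =>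
  (x == y) ||
  [exists e in E, exists f in E, [&& x \in e, y \in f & edge_joined E e f]].

(* The pair (S, F) is a connected subhypergraph of (T, E); the empty
   hypergraph does not count as connected. *)
Definition connected_sub (T : finType) (E : {set {set T}})
    (H : {set T} * {set {set T}}) :=
  [&& H.1 != set0, H.2 \subset E, [forall e in H.2, e \subset H.1]
    & [forall x in H.1, forall y in H.1, connected_in H.2 x y]].

Definition components (T : finType) (E : {set {set T}}) :
    {set {set T} * {set {set T}}} :=
  [set H | connected_sub E H &
     [forall K, connected_sub E K ==> (H.1 \subset K.1) ==>
                (H.2 \subset K.2) ==> (K == H)]].

(* Main.v *)
(** Add the edges one at a time, starting from the n isolated vertices, and put
    an edge in A as soon as two of its vertices are already connected.  The
    remaining edges form no cycle.  An edge of A merges at most two components,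
    any other edge merges three, so that n - p <= |A| + 2 (m - |A|). *)
Require Import Defs.
From mathcomp Require Import all_boot all_order all_algebra.
From mathcomp Require Import zify.

Local Open Scope ring_scope.

Section Adjacency.
Local Open Scope nat_scope.
Set Implicit Arguments.
Unset Strict Implicit.

Variable T : finType.
Implicit Types (E F A : {set {set T}}) (e : {set T}).

(** * Connectivity of vertices and the number of its classes *)

Definition adj E : rel T :=
  [rel x y | [exists e in E, (x \in e) && (y \in e)]].

Lemma adjP E x y :
  reflect (exists2 e, e \in E & (x \in e) && (y \in e)) (adj E x y).
Proof. exact: exists_inP. Qed.

Lemma adj_connect_sym E : connect_sym (adj E).
Proof.
apply: sym_connect_sym => x y; apply: eq_existsb => e.
by rewrite [(y \in e) && _]andbC.
Qed.

Lemma adj_connectS E F x y :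
  E \subset F -> connect (adj E) x y -> connect (adj F) x y.
Proof.
move=> /subsetP sEF; apply: connect_sub => {}x {}y /adjP[e /sEF eF xye].
by apply/connect1/adjP; exists e.
Qed.

(** A walk that uses [e] is cut where it first enters [e], at [a], and where it last leaves [e], at
    [b]; the stretch between them is dropped. *)
Lemma connect_adjU1 E e x y : connect (adj (e |: E)) x y ->
  connect (adj E) x y \/
  exists a b, [/\ a \in e, b \in e, connect (adj E) x a & connect (adj E) b y].
Proof.
case/connectP => p; elim: p x => [|z p IHp] x /=; first by move=> _ ->; left.
case/andP => /adjP[f]; rewrite !inE => fE /andP[xf zf] /IHp{}IHp /IHp{IHp}.
case/orP: fE => [/eqP fe|fE].
  rewrite {f}fe in xf zf; case=> [zy|[a [b [_ be _ by_]]]]; right.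
    by exists x, z.
  by exists x, b.
have xz : connect (adj E) x z by apply/connect1/adjP; exists f; rewrite ?xf.
case=> [zy|[a [b [ae be za by_]]]]; first by left; exact: connect_trans zy.
by right; exists a, b; split=> //; exact: connect_trans za.
Qed.

(** Each connectivity class is counted through its canonical representative, which makes it easy to
    follow the count when an edge is added. *)
Definition ncomp E := #|roots (adj E)|.

Lemma ncomp0 : ncomp set0 = #|T|.
Proof.
rewrite /ncomp; apply: eq_card => x; rewrite !inE /roots /=.
have /connectP[[|y p] /= pth ->] := connect_root (adj set0) x; first by rewrite eqxx.
by case/andP: pth => /adjP[e]; rewrite inE.
Qed.

(* Apart from the components of a and b, at most one component meets e, so
   the others stay pairwise distinct when e is added. *)
Lemma ncomp_setU1 E e a b c : e \subset [set a; b; c] ->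
  ncomp E <= ncomp (e |: E) + #|[set fingraph.root (adj E) a; fingraph.root (adj E) b]|.
Proof.
move=> /subsetP sub; set r := fingraph.root (adj E).
set r2 := fingraph.root (adj (e |: E)).
set B := [set _; _]; set D := [set x in roots (adj E)].
have -> : ncomp E = #|D| by rewrite cardsE.
(* Old representatives in [B] are paid for by the last term; those outside [B] are mapped
   injectively to new representatives by [r2]. *)
rewrite -(cardsID B D) addnC; apply: leq_add; last first.
  by rewrite subset_leq_card ?subsetIr.
rewrite -(@card_in_imset _ _ r2).
  apply/subset_leq_card/subsetP => y /imsetP[x _ ->].
  by rewrite unfold_in /=; exact: roots_root (adj_connect_sym _) x.
have hit x z : x \in D :\: B -> z \in e -> connect (adj E) x z -> x = r c.
  rewrite !inE => /andP[/norP[xa xb] /eqP rx] /sub zabc.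
  move/(fingraph.rootP (adj_connect_sym E)); rewrite rx; move: zabc.
  rewrite !inE => /orP[/orP[]|] /eqP-> // rxz.
  - by rewrite rxz eqxx in xa.
  - by rewrite rxz eqxx in xb.
move=> x y xD yD /(fingraph.rootP (adj_connect_sym _)) /connect_adjU1[|].
  move=> /(fingraph.rootP (adj_connect_sym _)).
  by move: xD yD; rewrite !inE => /andP[_ /eqP->] /andP[_ /eqP->].
case=> u [v [ue ve xu vy]]; rewrite (hit x u) // (hit y v) //.
by rewrite adj_connect_sym.
Qed.

(** * Cycles through an added edge *)

Lemma ordS_neq k (i : 'I_k) : 1 < k -> ordS i != i.
Proof.
move=> k2; apply/eqP => /(congr1 val) /=.
have := ltn_ord i; rewrite leq_eqVlt => /orP[/eqP ik|ik].
  by rewrite {1}ik modnn; lia.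
by rewrite modn_small //; lia.
Qed.

(** If a cycle uses [e], its edges are distinct, so the remaining ones lie in [E] and lead the long
    way round between two vertices of [e]. *)
Lemma cycle_setU1 E e : has_cycle (e |: E) ->
  has_cycle E \/ exists a b, [/\ a \in e, b \in e, a != b & connect (adj E) a b].
Proof.
case/has_cycleP => k [v [f /and5P[k2 injf injv /forallP fE /forallP vf]]].
case: (pickP (fun i => f i == e)) => [i /eqP fi|fNe]; last first.
  left; apply/has_cycleP; exists k, v, f; apply/and5P; split=> //.
    by apply/forallP => i; have := fE i; rewrite !inE fNe.
  exact/forallP.
right; exists (v (ordS i)), (v i).
have vfi j : (v j \in f j) && (v (ordS j) \in f j).
  by have := vf j; rewrite subUset !sub1set.
have /andP[vie vSie] := vfi i; rewrite -fi; split=> //.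
  by rewrite (inj_eq (injectiveP _ injv)) ordS_neq.
have inj_ordS : injective (@ordS k) by exact: bij_inj (@ordS_bij k).
suff walk t : connect (adj E) (v (ordS i)) (v (iter t (@ordS k) (ordS i))).
  have Si_i : fconnect (@ordS k) (ordS i) i.
    by rewrite fconnect_sym //; exact: fconnect1.
  by have := walk (findex (@ordS k) (ordS i) i); rewrite iter_findex.
elim: t => [|t IHt] /=; first exact: connect0.
set j := iter t _ _ in IHt *.
(* At index [i], the only one whose edge is [e], the next vertex is the starting point of the walk
   again, so [e] is never crossed. *)
have [->|ji] := eqVneq j i; first exact: connect0.
apply: connect_trans IHt _; apply/connect1/adjP; exists (f j) => //.
by have := fE j; rewrite !inE -fi (inj_eq (injectiveP _ injf)) (negPf ji).
Qed.

(** * Construction of the feedback edge set *)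

Lemma card3_sub e a b : #|e| = 3 -> a \in e -> b \in e -> a != b ->
  exists c, e \subset [set a; b; c].
Proof.
move=> e3 ae be ab; have : #|e :\ a :\ b| == 1.
  have := cardsD1 a e; have := cardsD1 b (e :\ a).
  by rewrite !inE ae be eq_sym ab e3; lia.
case/cards1P => c ec; exists c.
apply/subsetP => x xe; have := in_set1 c x; rewrite -ec !inE xe andbT.
by case: (x == a); case: (x == b) => //= <-.
Qed.

Lemma fes_ncomp E : uniform3 E ->
  exists2 A, fes E A & #|A| + #|T| <= 2 * #|E| + ncomp E.
Proof.
move: {2}#|E| (erefl #|E|) => m; elim: m E => [|m IHm] E cE uE.
  have E0 : E = set0 by apply/eqP; rewrite -cards_eq0 cE.
  by exists E; [exact: fes_edges | rewrite E0 cards0 ncomp0].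
have /card_gt0P[e eE] : 0 < #|E| by rewrite cE.
set E' := E :\ e; have defE : E = e |: E' by rewrite setD1K.
have cE' : #|E'| = m by have := cardsD1 e E; rewrite eE cE => -[].
have /eqP e3 : #|e| == 3 by exact: (forall_inP uE).
have uE' : uniform3 E'.
  by apply/forall_inP => f /setD1P[_ fE]; exact: (forall_inP uE).
have [A /andP[sA acA] leA] := IHm _ cE' uE'.
have eNA : e \notin A by apply: contraTN eE => /(subsetP sA); rewrite !inE eqxx.
(* [e] plays the edge added last. Connectivity is tested in all of [E'], edges of [A] included,
   because [ncomp] counts the classes of [E']. *)
case: (boolP [exists a in e, exists b in e, (a != b) && connect (adj E') a b]).
  case/exists_inP => a ae /exists_inP[b be /andP[ab cab]].
  have [c sube] := card3_sub e3 ae be ab.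
  exists (e |: A).
    rewrite /fes subUset sub1set eE (subset_trans sA (subD1set _ _)) /=.
    by rewrite -setDDl.
  (* As [a] and [b] share a root, the error set is a singleton: the count drops by at most one, and
     the other unit of the two that [e] contributes pays for its place in [A]. *)
  have := @ncomp_setU1 E' e a b c sube.
  rewrite -defE (fingraph.rootP (adj_connect_sym E') cab) setUid cards1.
  by rewrite cardsU1 eNA; lia.
move=> /exists_inPn NC.
have [a ae] : exists a, a \in e by apply/card_gt0P; rewrite e3.
have /card_gt0P[b /setD1P[ba be]] : 0 < #|e :\ a|.
  by have := cardsD1 a e; rewrite ae e3; lia.
have [c sube] : exists c, e \subset [set a; b; c].
  by apply: card3_sub; rewrite // eq_sym.
exists A.
  rewrite /fes (subset_trans sA (subD1set _ _)) /=.
  have -> : E :\: A = e |: (E' :\: A).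
    apply/setP => x; rewrite !inE; case: eqP => //= ->.
    by rewrite eNA eE.
  (* A cycle through [e] would connect two of its vertices by kept edges, hence in [E'], against
     [NC]. *)
  apply/negP => /cycle_setU1[|[x [y [xe ye xy cxy]]]]; first exact/negP.
  have /exists_inPn/(_ y ye) := NC x xe.
  by rewrite xy (adj_connectS _ cxy) // subsetDl.
have := @ncomp_setU1 E' e a b c sube.
rewrite -defE cards2 cE; move: leA; rewrite cE'.
by case: (_ != _); lia.
Qed.

(** * Comparison of the classes with the components *)

(** A sequence of edges becomes a walk on vertices by choosing a common point of each two
    consecutive edges. *)
Lemma connected_inW E F x y :
  F \subset E -> connected_in F x y -> connect (adj E) x y.
Proof.
move=> /subsetP sFE /orP[/eqP->|]; first exact: connect0.
case/exists_inP => e eF /exists_inP[f fF /and3P[xe yf /connectP[p]]].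
elim: p e x eF xe => [|g p IHp] e x eF xe /=.
  by move=> _ fe; apply/connect1/adjP; exists e; rewrite ?sFE // xe -fe.
case/andP => /and3P[_ gF /set0Pn[z /setIP[ze zg]]] pth lst.
apply: connect_trans (IHp g z gF zg pth lst).
by apply/connect1/adjP; exists e; rewrite ?sFE // xe.
Qed.

Lemma connected_in_trans E : transitive (connected_in E).
Proof.
move=> y x z /orP[/eqP-> //|/exists_inP[e eE /exists_inP[f fE]]].
case/and3P=> xe yf ef /orP[/eqP<-|/exists_inP[g gE /exists_inP[h hE]]].
  apply/orP; right; apply/exists_inP; exists e => //.
  by apply/exists_inP; exists f => //; rewrite xe yf.
case/and3P=> yg zh gh; apply/orP; right; apply/exists_inP; exists e => //.
apply/exists_inP; exists h => //; rewrite xe zh /=.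
apply: connect_trans ef (connect_trans (connect1 _) gh).
by rewrite /= fE gE /=; apply/set0Pn; exists y; rewrite inE yf.
Qed.

Definition comp_of E x : {set T} * {set {set T}} :=
  let X := [set y | connect (adj E) x y] in (X, [set e in E | e \subset X]).

Lemma comp_of_connected E x : connected_sub E (comp_of E x).
Proof.
apply/and4P; split=> /=.
- by apply/set0Pn; exists x; rewrite inE connect0.
- by apply/subsetP => e; rewrite inE => /andP[].
- by apply/forall_inP => e; rewrite inE => /andP[].
apply/forall_inP => y; rewrite inE => xy; apply/forall_inP => z.
rewrite inE => xz.
have: connect (adj E) y z.
  by apply: connect_trans xz; rewrite adj_connect_sym.
case/connectP => p; elim: p y xy => [|w p IHp] y xy /=.
  by move=> _ ->; rewrite /connected_in eqxx.
case/andP=> /adjP[e eE /andP[ye we]] pth lst.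
(* An edge that meets the class of [x] lies inside it, so the walk only uses edges of
   [comp_of E x]. *)
have sub : e \subset [set y | connect (adj E) x y].
  apply/subsetP => u ue; rewrite inE; apply: connect_trans xy (connect1 _).
  by apply/adjP; exists e; rewrite ?ye.
have xw : connect (adj E) x w by have := subsetP sub _ we; rewrite inE.
apply: connected_in_trans (IHp w xw pth lst).
have eF : e \in [set e in E | e \subset [set y | connect (adj E) x y]].
  by rewrite inE eE.
apply/orP; right; apply/exists_inP; exists e => //.
by apply/exists_inP; exists e => //; rewrite ye we; exact: connect0.
Qed.

(** Maximality: a connected subhypergraph containing [x] cannot leave the class of [x], and all
    edges of [E] inside that class are already present. *)
Lemma comp_of_component E x : comp_of E x \in components E.
Proof.
rewrite inE comp_of_connected; apply/forallP => -[X F].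
apply/implyP => /and4P[/= _ sFE /forall_inP FX /forall_inP cX].
apply/implyP => sX; apply/implyP => sF.
have xX : x \in X by apply: (subsetP sX); rewrite inE connect0.
have eX : X = [set y | connect (adj E) x y].
  apply/eqP; rewrite eqEsubset sX andbT; apply/subsetP => y yX.
  by rewrite inE; exact: connected_inW sFE (forall_inP (cX x xX) y yX).
rewrite /comp_of -eX xpair_eqE eqxx /= eqEsubset {2}eX sF andbT.
by apply/subsetP => e eF; rewrite inE (subsetP sFE) //= FX.
Qed.

(** Distinct representatives have distinct classes, so [comp_of] is injective on them. The bound
    goes this way because the components enter the theorem with a plus sign. *)
Lemma ncomp_le_components E : ncomp E <= #|components E|.
Proof.
rewrite /ncomp -cardsE -(@card_in_imset _ _ (comp_of E)).
  by apply/subset_leq_card/subsetP => _ /imsetP[x _ ->]; exact: comp_of_component.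
move=> x y; rewrite !inE => /eqP rx /eqP ry [/setP/(_ y)].
rewrite !inE connect0 => xy _; rewrite -rx -ry.
exact/(fingraph.rootP (adj_connect_sym E)).
Qed.

End Adjacency.

Theorem theorem3p1 (T : finType) (E : {set {set T}}) (hE : uniform3 E) :
  (tau E)%:Z <= 2%:Z * #|E|%:Z - #|T|%:Z + #|components E|%:Z.
Proof.
have [A fA leA] := fes_ncomp hE.
have := (tauP E).2 A fA; have := ncomp_le_components E.
by move: leA; lia.
Qed.
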